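(* For every $k\ge 2$, the quantities defined below satisfy $n(k,1)\ \ge\ f(k-1,1)\ \ge\ 2^{2^{k-4}}$.
   Context: Fix $k\ge 2$. Let $U$ be a finite set of pages and $\sigma=\sigma_1,\dots,\sigma_T$ with $\sigma_t\in U$. A ($k$-level, hierarchical) service pattern is $\mathcal I=\mathcal I_1\cup\dots\cup\mathcal I_k$, where each $\mathcal I_i$ (the level-$i$ intervals) is a partition of $[0,T+1)$ into half-open intervals with integer endpoints, such that every level-$i$ interval with $i<k$ is contained in a level-$(i+1)$ interval (its parent). The ancestors $A(I)$ of $I$ are the higher-level intervals containing $I$; $T_I$ consists of $I$ and all lower-level intervals contained in $I$; the children of a level-$\ell$ interval $I$ are the level-$(\ell-1)$ intervals contained in it. A labeling is a partial map $\alpha$ from intervals to $U$; a labeling of a set $\mathcal J$ of intervals is feasible for $\sigma_I$ (the requests at times $t\in I\cap\{1,\dots,T\}$) if for every such $t$ some $J\in\mathcal J$ with $t\in J$ has $\alpha(J)=\sigma_t$. For a level-$\ell$ interval $I$ with $\ell<k$, a set $S\subseteq U$ with $|S|\le k-\ell$ is a valid tuple if some labeling of $T_I\cup A(I)$, feasible for $\sigma_I$, labels every ancestor of $I$ either not at all or by an element of $S$; the request list $L(I)$ is the set of inclusion-minimal valid tuples. For a level-$\ell$ interval $I$ with $\ell\ge2$ and children $C$, the joint request list $L(C)$ is the set of inclusion-minimal $S\subseteq U$ with $|S|\le k-\ell+1$ such that some labeling of $T_I\cup A(I)$, feasible for $\sigma_I$, labels each interval of $\{I\}\cup A(I)$ either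 not at all or by an element of $S$. A $t$-tuple is a set of size $t$. $f(\ell,t)$ is the supremum, over all $U,\sigma$, $k$-level service patterns and level-$\ell$ intervals $I$, of the number of $t$-tuples in $L(I)$; $n(\ell,t)$ is the analogous supremum of the number of $t$-tuples in the joint request list $L(C)$ of the children of a level-$\ell$ interval. *)

(* Defs.v *)
From mathcomp Require Import all_boot all_order all_algebra.
From mathcomp Require Import all_classical all_reals all_analysis.

Set Implicit Arguments.
Unset Strict Implicit.
Unset Printing Implicit Defensive.

Import Order.TTheory GRing.Theory Num.Theory.

(* A half-open interval [a, b) of [0, T+1) with integer endpoints is represented
   by the set of its integer points, a subset of {0, ..., T}; containment,
   disjointness and covering are preserved and reflected. *)
Definition half_open (T : nat) (B : {set 'I_T.+1}) : Prop :=
  exists a b : nat, B = [set t : 'I_T.+1 | a <= t < b]%SET.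

(* Only the values of [level_intervals] at the levels 1, ..., k are meaningful. *)
Record service_pattern (k T : nat) := ServicePattern {
  level_intervals :> nat -> {set {set 'I_T.+1}};
  _ : forall i, 0 < i <= k ->
        finset.partition (level_intervals i) [set: 'I_T.+1]%SET;
  _ : forall i B, 0 < i <= k -> B \in level_intervals i -> half_open B;
  _ : forall i B, 0 < i < k -> B \in level_intervals i ->
        exists2 B', B' \in level_intervals i.+1 & B \subset B'
}.

(* Intervals are tagged by their level: the same set of times may occur at
   several levels, and these occurrences are labeled independently. *)
Definition leveled_interval (T : nat) : Type := nat * {set 'I_T.+1}.

Section Pattern.
Variables (k T : nat) (P : service_pattern k T).
Implicit Types I J : leveled_interval T.

Definition pattern_intervals : pred (leveled_interval T) :=
  fun J => (0 < J.1 <= k) && (J.2 \in P J.1).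

Definition ancestors I : pred (leveled_interval T) :=
  fun J => [&& pattern_intervals J, I.1 < J.1 & I.2 \subset J.2].

Definition subtree I : pred (leveled_interval T) :=
  fun J => pattern_intervals J &&
    ((J == I) || (J.1 < I.1) && (J.2 \subset I.2)).

End Pattern.

Definition labeling (T : nat) (U : finType) := leveled_interval T -> option U.

(* The request [sigma r] with [r : 'I_T] is issued at time [r + 1], that is,
   at [lift ord0 r : 'I_T.+1]; there is no request at time 0. *)
Definition feasible (T : nat) (U : finType) (sigma : 'I_T -> U)
    (Js : pred (leveled_interval T)) (I : leveled_interval T) (alpha : labeling T U) : Prop :=
  forall r : 'I_T, lift ord0 r \in I.2 ->
    exists J, [/\ Js J, lift ord0 r \in J.2 & alpha J = Some (sigma r)].

Definition unlabeled_or_in (T : nat) (U : finType) (alpha : labeling T U)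
    (S : {set U}) (J : leveled_interval T) : Prop :=
  alpha J = None \/ exists2 u, u \in S & alpha J = Some u.

Section RequestLists.
Variables (k T : nat) (U : finType) (sigma : 'I_T -> U).
Variable P : service_pattern k T.
Implicit Types (I : leveled_interval T) (S : {set U}).

Definition valid_tuple I S : Prop :=
  #|S| <= k - I.1 /\
  exists alpha : labeling T U,
    feasible sigma [predU subtree P I & ancestors P I] I alpha /\
    forall J, ancestors P I J -> unlabeled_or_in alpha S J.

Definition request_list I : {set {set U}} :=
  [set S | minset (fun S' => `[< valid_tuple I S' >]) S]%SET.

Definition joint_valid_tuple I S : Prop :=
  #|S| <= k - I.1 + 1 /\
  exists alpha : labeling T U,
    feasible sigma [predU subtree P I & ancestors P I] I alpha /\
    forall J, J = I \/ ancestors P I J -> unlabeled_or_in alpha S J.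

(* The joint request list L(C), where C is the set of children of [I]. *)
Definition joint_request_list I : {set {set U}} :=
  [set S | minset (fun S' => `[< joint_valid_tuple I S' >]) S]%SET.

End RequestLists.

Definition num_tuples (U : finType) (L : {set {set U}}) (t : nat) : nat :=
  #|[set S in L | #|S| == t]%SET|.

(* The suprema are taken in the extended reals, so no finiteness is assumed. *)
Definition f_sup (R : realType) (k l t : nat) : \bar R :=
  ereal_sup [set x : \bar R |
    exists (U : finType) (T : nat) (sigma : 'I_T -> U)
           (P : service_pattern k T) (I : leveled_interval T),
      [/\ pattern_intervals P I, I.1 = l
        & x = ((num_tuples (request_list sigma P I) t)%:R%R)%:E]]%classic.

Definition n_sup (R : realType) (k l t : nat) : \bar R :=
  ereal_sup [set x : \bar R |
    exists (U : finType) (T : nat) (sigma : 'I_T -> U)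
           (P : service_pattern k T) (I : leveled_interval T),
      [/\ pattern_intervals P I, I.1 = l
        & x = ((num_tuples (joint_request_list sigma P I) t)%:R%R)%:E]]%classic.

(* Main.v *)
Require Import Defs.
From mathcomp Require Import all_boot all_order all_algebra.
From mathcomp Require Import all_classical all_reals all_analysis.
From mathcomp Require Import zify.

Set Implicit Arguments.
Unset Strict Implicit.
Unset Printing Implicit Defensive.

Import Order.TTheory GRing.Theory Num.Theory.

(** Lower bound on [f]. Call a set [A] of pages selectable at height [h] if some
    tree of intervals of height [h] can be served with the help of a set [S] of
    ancestor labels exactly when [S] meets [A]. If [A0] is a set of [N] pages and
    every [x] in [A0] has a private set [F x] of further pages, put the sets
    [C x = (A0 :\ x) :|: F x] next to each other under a common parent: no single
    page meets all the [C x], but [{a, a'}] does for distinct [a], [a'] in [A0],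
    and so does [{x, p}] for [p] in [F x]. As the parent supplies one label, the
    union of [A0] and all the [F x] is selectable at height [h + 1]. With [N] and
    [#|F x|] about half of the largest selectable size at height [h], this size is
    essentially squared by each additional level. The pages of a set selectable at
    height [k - 1] are the singletons of a request list.

    Comparison of [n] and [f]. Replace the top level by a single interval and all
    requests outside the given level-[k-1] interval [I] by one fixed page, which
    the other level-[k-1] intervals can serve: the joint request list of the new
    pattern is [L(I)]. *)

(** * Selectable sets of pages *)

Section Selectors.
Variable U : finType.
Implicit Types (s : nat -> U) (S A : {set U}).

(* The leaves of the complete [b]-ary tree of height [h] are numbered by
   [r < b ^ h]; [g i j] is the label of the [j]-th node of height [i], and [S] is
   the set of labels available above the root. *)
Definition servable (b h : nat) s S : Prop :=
  exists g : nat -> nat -> U, forall r, r < b ^ h ->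
    s r \in S \/ exists2 i, 0 < i <= h & g i (r %/ b ^ i) = s r.

Lemma eq_servable b h s s' S :
  (forall r, r < b ^ h -> s r = s' r) -> servable b h s S -> servable b h s' S.
Proof.
move=> ss' [g gP]; exists g => r rb; rewrite -ss' //; exact: gP.
Qed.

Lemma servable0 b s S : servable b 0 s S <-> s 0 \in S.
Proof.
split=> [[g /(_ 0 isT)]|sS]; last by exists (fun _ _ => s 0); case=> //; left.
by case=> // -[i] /andP[i0]; rewrite leqNgt i0.
Qed.

Lemma divn_block b h i c r : 0 < b -> i <= h ->
  (c * b ^ h + r) %/ b ^ i = c * b ^ (h - i) + r %/ b ^ i.
Proof.
move=> b0 ih; rewrite -{1}(subnK ih) expnD mulnA divnMDl // expn_gt0 b0 //.
Qed.

(** The label [p] of the root acts, inside each child subtree, as one more label available from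
    above. *)
Lemma servableS b h s S : 0 < b ->
  servable b h.+1 s S <->
  exists p, forall c, c < b ->
    servable b h (fun r => s (c * b ^ h + r)) (p |: S)%SET.
Proof.
move=> b0; split=> [[g gP]|[p pP]].
  exists (g h.+1 0) => c cb; exists (fun i j => g i (c * b ^ (h - i) + j)) => r rb.
  have crb : c * b ^ h + r < b ^ h.+1.
    rewrite expnS; apply: (@leq_trans (c.+1 * b ^ h)); last by rewrite leq_mul2r cb orbT.
    by rewrite mulSn addnC ltn_add2r.
  have [sS|[i /andP[i0]]] := gP _ crb; first by left; rewrite inE sS orbT.
  rewrite leq_eqVlt => /orP[/eqP->|ih].
    by rewrite divn_small // => <-; left; rewrite !inE eqxx.
  rewrite divn_block // => gE; right; exists i => //.
  by rewrite i0.
have /boolp.choice[g gP] : forall c, exists g : nat -> nat -> U, c < b ->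
    forall r, r < b ^ h -> s (c * b ^ h + r) \in (p |: S)%SET \/
    exists2 i, 0 < i <= h & g i (r %/ b ^ i) = s (c * b ^ h + r).
  move=> c; have [cb|_] := boolP (c < b); last by exists (fun _ _ => p).
  by have [g gP] := pP c cb; exists g.
(* Node [j] of height [i] lies in child subtree [j %/ b ^ (h - i)], where its index is the
   remainder. *)
exists (fun i j => if i == h.+1 then p
                   else g (j %/ b ^ (h - i)) i (j %% b ^ (h - i))) => r rb.
have bh0 : 0 < b ^ h by rewrite expn_gt0 b0.
have cb : r %/ b ^ h < b by rewrite ltn_divLR // -expnS.
have := gP _ cb (r %% b ^ h) (ltn_pmod _ bh0).
rewrite -divn_eq => -[|[i /andP[i0 ih] gE]].
  rewrite !inE => /orP[/eqP sp|sS]; last by left.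
  by right; exists h.+1; rewrite ?leqnn // eqxx.
right; exists i; first by rewrite i0 leqW.
have -> : r %/ b ^ i = r %/ b ^ h * b ^ (h - i) + (r %% b ^ h) %/ b ^ i.
  by rewrite {1}(divn_eq r (b ^ h)) divn_block.
rewrite ltn_eqF // -gE.
have rlt : (r %% b ^ h) %/ b ^ i < b ^ (h - i).
  by rewrite ltn_divLR ?expn_gt0 ?b0 // -expnD subnK // ltn_pmod.
by rewrite divnMDl ?modnMDl ?expn_gt0 ?b0 // (divn_small rlt) addn0 (modn_small rlt).
Qed.

(* With branching [#|U|], the children of a node can be indexed by pages. *)
Definition selector (h : nat) A : Prop :=
  exists s, forall S, servable #|U| h s S <-> exists2 a, a \in A & a \in S.

Lemma selector1 a : selector 0 [set a]%SET.
Proof.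
exists (fun=> a) => S; split=> [/servable0 aS|[x]].
  by exists a; rewrite ?inE.
by rewrite inE => /eqP-> aS; apply/servable0.
Qed.

(** The child indexed by [x] repeats a sequence selecting [C x]. Whatever the root label, some [C x]
    avoids it, so [S] itself must meet that [C x]; conversely, a page of [A] in [S] is completed by
    its partner [q] as root label. *)
Lemma selectorS h A (C : U -> {set U}) (x0 : U) :
  (forall x, selector h (C x)) -> (forall x, C x \subset A) ->
  {in A, forall p, exists q, forall x, (p \in C x) || (q \in C x)} ->
  (forall q, exists x, q \notin C x) ->
  selector h.+1 A.
Proof.
move=> /boolp.choice[s sP] CA pair unstab.
have U0 : 0 < #|U| by apply/card_gt0P; exists x0.
have Uh0 : 0 < #|U| ^ h by rewrite expn_gt0 U0.
exists (fun r => s (nth x0 (enum U) (r %/ #|U| ^ h)) (r %% #|U| ^ h)) => S.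
have blockE c r : r < #|U| ^ h ->
    s (nth x0 (enum U) ((c * #|U| ^ h + r) %/ #|U| ^ h))
      ((c * #|U| ^ h + r) %% #|U| ^ h) = s (nth x0 (enum U) c) r.
  by move=> rU; rewrite divnMDl // modnMDl divn_small // addn0 modn_small.
split=> [/(servableS _ _ _ U0)[p pP]|[a aA aS]].
  have [x pCx] := unstab p.
  have /pP/(eq_servable (blockE _)) : index x (enum U) < #|U|.
    by rewrite cardE index_mem mem_enum.
  rewrite nth_index ?mem_enum // => /sP[a aCx]; rewrite !inE => /orP[/eqP ap|aS].
    by rewrite -ap aCx in pCx.
  by exists a => //; apply: (fintype.subsetP (CA x)).
apply/servableS => //; have [q qP] := pair _ aA; exists q => c cU.
apply: (@eq_servable _ _ (s (nth x0 (enum U) c))) => [r rU|]; first by rewrite blockE.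
apply/sP; have /orP[aC|qC] := qP (nth x0 (enum U) c).
  by exists a => //; rewrite !inE aS orbT.
by exists q => //; rewrite !inE eqxx.
Qed.

(** Cut an enumeration of [B] into runs of length [M] and send each run to one element of [A]; ranks
    modulo [M] are injective on a fibre. *)
Lemma spread (A B : {set U}) M : #|B| <= #|A| * M ->
  exists phi : U -> U, {in B, forall p, phi p \in A} /\
    forall x, #|[set p in B | phi p == x]%SET| <= M.
Proof.
have [->|[b0 b0B]] := finset.set_0Vmem B.
  exists id; split=> [p|x]; first by rewrite inE.
  by rewrite (_ : [set _ in _ | _]%SET = finset.set0) ?cards0 //; apply/setP => p; rewrite !inE.
case: M => [|M BA]; first by rewrite muln0 leqn0 cards_eq0 => /eqP B0; rewrite B0 inE in b0B.
pose rk p := index p (enum B).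
have rkB p : p \in B -> rk p < #|B| by move=> pB; rewrite cardE index_mem mem_enum.
have qA p : p \in B -> rk p %/ M.+1 < size (enum A).
  by move=> /rkB pB; rewrite -cardE ltn_divLR // (leq_trans pB).
exists (fun p => nth b0 (enum A) (rk p %/ M.+1)); split=> [p pB|x].
  by rewrite -mem_enum mem_nth // qA.
rewrite -[X in _ <= X]card_ord.
rewrite -(@card_in_imset _ _ (fun p => inord (rk p %% M.+1) : 'I_M.+1)).
  exact: max_card.
move=> p q; rewrite !inE => /andP[pB /eqP px] /andP[qB /eqP qx] /(congr1 val) /=.
rewrite !inordK ?ltn_pmod // => pq.
have /eqP : nth b0 (enum A) (rk p %/ M.+1) = nth b0 (enum A) (rk q %/ M.+1) by rewrite px qx.
rewrite nth_uniq ?enum_uniq ?qA // => /eqP pq'.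
have rkpq : rk p = rk q by rewrite (divn_eq (rk p) M.+1) pq pq' -divn_eq.
by rewrite -(@nth_index _ b0 p (enum B)) ?mem_enum // -/(rk p) rkpq nth_index // mem_enum.
Qed.

(** The fibres of [phi] serve as the private sets. Each has at most [hi.+1 - N] pages, so every
    [C x] has between [N - 1 >= lo] and [hi] pages. *)
Lemma selector_grow h (lo hi N : nat) A :
  (forall B : {set U}, lo <= #|B| <= hi -> selector h B) ->
  1 < N -> lo < N <= hi.+1 -> N <= #|A| <= N + N * (hi.+1 - N) ->
  selector h.+1 A.
Proof.
move=> selh N1 /andP[loN Nhi] /andP[NA AN].
have [s0 [s0u s0N s0A]] := card_geqP NA.
pose A0 := [set x in s0]%SET.
have A0N : #|A0| = N by rewrite -s0N; rewrite cardsE; apply/card_uniqP.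
have A0A : A0 \subset A by apply/fintype.subsetP => x; rewrite inE => /s0A.
have [|phi [phiA0 phiM]] := @spread A0 (A :\: A0)%SET (hi.+1 - N).
  by rewrite cardsDS // A0N; lia.
have other x : exists2 y, y \in A0 & y != x.
  have : 0 < #|A0 :\ x|%SET by have := cardsD1 x A0; lia.
  by case/card_gt0P => y; rewrite !inE => /andP[yx yA0]; exists y; rewrite // inE.
have [x0 x0A0] : exists x, x \in A0 by apply/card_gt0P; lia.
(* Children are indexed by all pages; [r] retracts the index set onto [A0], so that some children
   are merely repeated. *)
pose r x := if x \in A0 then x else x0.
have rA0 x : r x \in A0 by rewrite /r; case: ifP.
pose C x := ((A0 :\ r x) :|: [set p in A :\: A0 | phi p == r x])%SET.
have CE x p : (p \in C x) =
    (p != r x) && (p \in A0) || [&& p \notin A0, p \in A & phi p == r x].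
  by rewrite !inE -andbA.
apply: (@selectorS h A C x0) => [x|x|p pA|q].
- apply: selh; rewrite cardsU (_ : _ :&: _ = finset.set0)%SET; last first.
    by apply/setP => p; rewrite !inE; case: (p \in s0); rewrite ?andbF.
  by have := phiM (r x); have := cardsD1 (r x) A0; rewrite cards0 rA0; lia.
- apply/fintype.subsetP => p; rewrite CE => /orP[/andP[_ /(fintype.subsetP A0A)]//|].
  by case/and3P.
(* Two distinct pages of [A0] are partners; a private page [p] is paired with [phi p], as the only
   set lacking [phi p] contains [p]. *)
- have [pA0|pA0] := boolP (p \in A0).
    have [q qA0 qp] := other p; exists q => x; rewrite !CE pA0 qA0 /= !andbT.
    by case: eqP => //= <-; rewrite qp.
  have phip : phi p \in A0 by apply: phiA0; rewrite inE pA0.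
  exists (phi p) => x; rewrite !CE pA0 pA phip (negbTE pA0) /= andbF andbT orbF /=.
  by case: eqP.
- have [qA0|qA0] := boolP (q \in A0).
    by exists q; rewrite CE /r qA0 eqxx.
  have [y yA0 yq] := other (phi q); exists y.
  by rewrite CE /r yA0 (negbTE qA0) andbF /= eq_sym (negbTE yq) andbF.
Qed.

(** No page lies in both sets, while a page of one can be paired with any page of the other. This
    yields size 4 at height 2, where [selector_grow] applied to pairs reaches only size 3. *)
Lemma selectorU h A B : selector h A -> selector h B -> [disjoint A & B] ->
  A != finset.set0 -> B != finset.set0 -> selector h.+1 (A :|: B)%SET.
Proof.
move=> selA selB dAB /set0Pn[a aA] /set0Pn[b bB].
pose C x := if x == a then A else B.
have abF : (b == a) = false.
  by apply/eqP => ba; rewrite ba (disjointFr dAB aA) in bB.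
apply: (@selectorS h _ C a) => [x|x|p|q].
- by rewrite /C; case: ifP.
- by rewrite /C; case: ifP => _; rewrite ?finset.subsetUl ?finset.subsetUr.
- rewrite inE => /orP[pA|pB].
    by exists b => x; rewrite /C; case: ifP; rewrite ?pA ?bB ?orbT.
  by exists a => x; rewrite /C; case: ifP; rewrite ?pB ?aA ?orbT.
- have [qA|qA] := boolP (q \in A); last by exists a; rewrite /C eqxx.
  by exists b; rewrite /C abF (disjointFr dAB qA).
Qed.

Lemma selector_pair A : #|A| = 2 -> selector 1 A.
Proof.
move=> A2; apply: (@selector_grow 0 1 1 2); rewrite ?A2 // => B.
by rewrite -eqn_leq eq_sym => /cards1P[x ->]; apply: selector1.
Qed.

Lemma selector_three_four A : 2 < #|A| <= 4 -> selector 2 A.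
Proof.
move=> /andP[A2]; rewrite leq_eqVlt => /orP[/eqP A4|A4]; last first.
  apply: (@selector_grow 1 2 2 3) => // [B|]; last lia.
  by rewrite -eqn_leq => /eqP B2; apply: selector_pair.
have [s [su s2 sA]] := card_geqP (ltnW A2 : 2 <= #|A|).
have B2 : #|[set x in s]%SET| = 2 by rewrite cardsE -s2; apply/card_uniqP.
have BA : [set x in s]%SET \subset A by apply/fintype.subsetP => x; rewrite inE => /sA.
have D2 : #|A :\: [set x in s]|%SET = 2 by rewrite cardsDS // B2 A4.
have -> : A = ([set x in s] :|: (A :\: [set x in s]))%SET.
  by rewrite -{1}(finset.setID A [set x in s]%SET) (finset.setIidPr BA).
apply: selectorU; rewrite -?card_gt0 ?B2 ?D2 //; try exact: selector_pair.
by rewrite -setI_eq0; apply/eqP/setP => x; rewrite !inE; case: (x \in s); rewrite ?andbF.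
Qed.

(** With [W = 2 ^ 2 ^ j], the choice [N = 2 * W + 1] turns the range from [2 * W] to [4 * W] into
    the range from [2 * W + 1] to [(2 * W + 1) ^ 2], which covers [2 * W ^ 2] to [4 * W ^ 2] because
    [W >= 2]. *)
Lemma selector_double_exp j A :
  2 * 2 ^ 2 ^ j <= #|A| <= 4 * 2 ^ 2 ^ j -> selector j.+3 A.
Proof.
elim: j A => [|j IHj] A.
  rewrite expn0 expn1 => A48; apply: (@selector_grow 2 3 4 4) => // B.
  exact: selector_three_four.
have W2 : 1 < 2 ^ 2 ^ j by rewrite -{1}(expn0 2) ltn_exp2l // expn_gt0.
rewrite expnS [2 * 2 ^ j]mulnC expnM.
move: IHj W2; set W := 2 ^ 2 ^ j => IHj W2 /andP[WA AW].
by apply: (selector_grow (N := (2 * W).+1) IHj); nia.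
Qed.

End Selectors.

(** * Regular [b]-ary patterns and their request lists *)

Section RegularPattern.
Variables (b : nat) (b0 : 0 < b).

(* The request [r : 'I_T] occurs at time [r + 1], so [t.-1] is the leaf of time
   [t]; time [0], which has no request, is put together with time [1]. *)
Definition block (T i j : nat) : {set 'I_T.+1} :=
  [set t : 'I_T.+1 | t.-1 %/ b ^ i == j]%SET.

Definition blocks (T i : nat) : {set {set 'I_T.+1}} :=
  preim_partition (fun t : 'I_T.+1 => t.-1 %/ b ^ i) [set: 'I_T.+1]%SET.

Lemma blocksP T i B :
  reflect (exists t : 'I_T.+1, B = block T i (t.-1 %/ b ^ i)) (B \in blocks T i).
Proof.
apply: (iffP imsetP) => [[t _ ->]|[t ->]]; exists t => //;
by apply/setP => u; rewrite !inE /= eq_sym.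
Qed.

Lemma mem_blocks T i (t : 'I_T.+1) : block T i (t.-1 %/ b ^ i) \in blocks T i.
Proof. by apply/blocksP; exists t. Qed.

Lemma block_half_open T i j : half_open (block T i j).
Proof.
have bi0 : 0 < b ^ i by rewrite expn_gt0 b0.
(* Times are leaves shifted by one, but block [0] starts at [0] rather than [1] to contain time
   [0]. *)
exists (if j == 0 then 0 else (j * b ^ i).+1), (j.+1 * b ^ i).+1.
apply/setP => t; rewrite !inE eqn_leq -ltnS ltn_divLR // leq_divRL //.
by case: j => [|j]; rewrite /=; nia.
Qed.

Lemma block_sub T i j : block T i j \subset block T i.+1 (j %/ b).
Proof.
by apply/fintype.subsetP => t; rewrite !inE => /eqP <-; rewrite -divnMA -expnSr.
Qed.

Definition regular_pattern (k T : nat) : service_pattern k T.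
Proof.
refine (@ServicePattern k T (blocks T) _ _ _) => i.
- by move=> _; apply: preim_partitionP.
- by move=> B _ /blocksP[t ->]; apply: block_half_open.
- move=> B _ /blocksP[t ->].
  exists (block T i.+1 (t.-1 %/ b ^ i.+1)); first exact: mem_blocks.
  by rewrite expnSr divnMA block_sub.
Defined.

Lemma block_full d i : d <= i -> block (b ^ d) i 0 = [set: 'I_(b ^ d).+1]%SET.
Proof.
move=> di; apply/setP => t; rewrite !inE divn_small //.
apply: leq_trans (_ : b ^ d <= b ^ i); last by rewrite leq_pexp2l.
have bd0 : 0 < b ^ d by rewrite expn_gt0 b0.
by have := ltn_ord t; lia.
Qed.

Lemma full_blocks d i : d <= i -> [set: 'I_(b ^ d).+1]%SET \in blocks (b ^ d) i.
Proof. by move=> di; rewrite -(block_full di); apply/blocksP; exists ord0; rewrite div0n. Qed.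

(** The level-[d] interval has a single ancestor; as [S] has at most one page, this ancestor can
    offer all of [S]. *)
Lemma valid_regular (U : finType) d (s : nat -> U) (S : {set U}) : 0 < d ->
  valid_tuple (fun r : 'I_(b ^ d) => s r) (regular_pattern d.+1 (b ^ d))
    (d, [set: 'I_(b ^ d).+1]%SET) S <->
  #|S| <= 1 /\ servable b d s S.
Proof.
move=> d0; set P := regular_pattern _ _; set I := (d, _).
have topI : ancestors P I (d.+1, [set: 'I_(b ^ d).+1]%SET).
  by rewrite /ancestors /pattern_intervals /= !ltnSn full_blocks //= fintype.subxx.
have ancI J : ancestors P I J -> J.1 = d.+1.
  by case/and3P => /andP[/andP[_ ?] _] /= ? _; apply/eqP; rewrite eqn_leq; apply/andP.
have lift_block r (rb : r < b ^ d) i B : B \in blocks (b ^ d) i ->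
    lift ord0 (Ordinal rb) \in B -> B = block (b ^ d) i (r %/ b ^ i).
  by move=> /blocksP[t ->]; rewrite inE /= => /eqP->.
rewrite /valid_tuple subSnn; split=> -[S1 H]; (split=> //).
  have [alpha [feas anc]] := H.
  exists (fun i j => odflt (s 0) (alpha (i, block (b ^ d) i j))) => r rb.
  have [|[i B] [JI rJ aJ]] := feas (Ordinal rb); first by rewrite inE.
  have [/andP[/andP[/andP[/= i0 _] /= BP] Jd]|/anc[|[u uS]]] := orP JI.
  - right; exists i; last by rewrite -(lift_block _ rb _ _ BP rJ) aJ.
    by rewrite i0 /=; case/orP: Jd => [/eqP/(congr1 fst)/= ->|/andP[/ltnW]].
  - by rewrite aJ.
  - by rewrite aJ => -[->]; left.
case: H => g gP.
(* The index of a block is recovered from an arbitrary time in it. *)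
exists (fun J : leveled_interval (b ^ d) => if J.1 == d.+1 then [pick u in S]
  else if [pick t in J.2] is Some t then Some (g J.1 (t.-1 %/ b ^ J.1)) else None).
split=> [[r rb] _|J /ancI JE]; last first.
  by rewrite /unlabeled_or_in JE eqxx; case: pickP => [u uS|_]; [right; exists u|left].
have [rS|[i /andP[i0 id] gE]] := gP r rb.
  exists (d.+1, [set: 'I_(b ^ d).+1]%SET); split; [by apply/orP; right|by rewrite inE|].
  rewrite eqxx; case: pickP => [u uS|/(_ (s r))]; last by rewrite rS.
  by congr Some; apply: (card_le1_eqP S1).
exists (i, block (b ^ d) i (r %/ b ^ i)); split.
- apply/orP; left; rewrite unfold_in /pattern_intervals /= i0 leqW //=.
  have /= -> := mem_blocks i (lift ord0 (Ordinal rb)).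
  rewrite finset.subsetT andbT /=; move: id; rewrite leq_eqVlt => /orP[/eqP ->|->].
    rewrite divn_small // block_full ?eqxx //.
  by rewrite orbT.
- by rewrite inE.
- rewrite /= ltn_eqF //; case: pickP => [t|/(_ (lift ord0 (Ordinal rb)))].
    by rewrite inE => /eqP->; rewrite gE.
  by rewrite inE /= eqxx.
Qed.

End RegularPattern.

(** When all [n] pages form the selected set, the empty set is not valid and every singleton is, so
    all singletons are minimal. *)
Lemma f_sup_ge (R : realType) (d n : nat) : 0 < d -> 0 < n ->
  selector d [set: 'I_n]%SET -> (n%:R%R%:E <= f_sup R d.+1 d 1)%E.
Proof.
move=> d0 n0 [s sP]; rewrite card_ord in sP.
pose T := n ^ d; pose P := regular_pattern n0 d.+1 T.
pose I : leveled_interval T := (d, [set: 'I_T.+1]%SET).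
pose L := request_list (fun r : 'I_T => s r) P I.
have L1 p : [set p]%SET \in L.
  rewrite inE; apply/finset.minsetP; split=> [|B /asboolP/(valid_regular _ _ _ d0)[_]].
    apply/asboolP/valid_regular => //; rewrite cards1; split=> //.
    by apply/sP; exists p; rewrite !inE.
  move=> /sP[a _ aB]; rewrite finset.subset1 => /orP[/eqP//|/eqP B0].
  by rewrite B0 inE in aB.
apply: le_trans (_ : ((num_tuples L 1)%:R%R)%:E <= _)%E; last first.
  apply: ereal_sup_ubound; exists 'I_n, T, (fun r => s r), P, I; split=> //.
  by rewrite /pattern_intervals /= d0 leqnSn full_blocks.
rewrite lee_fin ler_nat -[X in (X <= _)%N](card_ord n) -cardsT.
rewrite -(card_imset _ (@set1_inj _)); apply: fintype.subset_leq_card.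
by apply/fintype.subsetP => B /imsetP[p _ ->]; rewrite inE L1 cards1.
Qed.

(** * Merging the top level into one interval *)

Section Flatten.
Variables (k T : nat) (P : service_pattern k T).

Lemma pattern_partition i : 0 < i <= k -> finset.partition (P i) [set: 'I_T.+1]%SET.
Proof. by case: P => L Lpart ? ?; apply: Lpart. Qed.

Lemma pattern_half_open i B : 0 < i <= k -> B \in P i -> half_open B.
Proof. by case: P => L ? Lho ?; apply: Lho. Qed.

Lemma pattern_parent i B : 0 < i < k -> B \in P i ->
  exists2 B', B' \in P i.+1 & B \subset B'.
Proof. by case: P => L ? ? Lpar; apply: Lpar. Qed.

Lemma pattern_ancestor i j B : 0 < i <= j -> j <= k -> B \in P i ->
  exists2 B', B' \in P j & B \subset B'.
Proof.
elim: j => [|j IHj] /andP[i0 ij] jk BP; first by move: (leq_trans i0 ij).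
move: ij; rewrite leq_eqVlt => /orP[/eqP ij|ij]; first by exists B; rewrite -?ij.
have [||B' B'P BB'] := IHj _ _ BP; [by rewrite i0|exact: ltnW|].
have [|B'' B''P B'B''] := pattern_parent _ B'P; first by rewrite jk (leq_trans i0).
by exists B''; rewrite ?(fintype.subset_trans BB').
Qed.

Lemma pattern_eq i B B' t : 0 < i <= k -> B \in P i -> B' \in P i ->
  t \in B -> t \in B' -> B = B'.
Proof.
move=> /pattern_partition/and3P[_ tP _] BP B'P tB tB'.
by rewrite -(finset.def_pblock tP BP tB) (finset.def_pblock tP B'P tB').
Qed.

Lemma pattern_cover i t : 0 < i <= k -> exists2 B, B \in P i & t \in B.
Proof.
move=> /pattern_partition/and3P[/eqP cP _ _].
have tP : t \in finset.cover (P i) by rewrite cP inE.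
by exists (finset.pblock (P i) t); rewrite ?finset.pblock_mem ?finset.mem_pblock.
Qed.

Lemma pattern_nonempty i B : 0 < i <= k -> B \in P i -> exists t, t \in B.
Proof.
move=> /pattern_partition/and3P[_ _ P0] BP; apply/set0Pn.
by apply: contraNneq P0 => <-.
Qed.

Definition flatten_top : service_pattern k T.
Proof.
refine (@ServicePattern k T
  (fun i => if i == k then [set [set: 'I_T.+1]]%SET else P i) _ _ _) => i.
- case: eqP => [_ _|_]; last exact: pattern_partition.
  apply/and3P; split.
  + by rewrite /finset.cover finset.big_set1.
  + by apply/finset.trivIsetP => B B'; rewrite !inE => /eqP-> /eqP->; rewrite eqxx.
  + by rewrite inE; apply/eqP => /setP/(_ ord0); rewrite !inE.
- move=> B; case: eqP => [_ _|_]; last exact: pattern_half_open.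
  rewrite inE => /eqP->; exists 0, T.+1.
  by apply/setP => t; rewrite !inE ltn_ord.
- move=> B ik; have /ltn_eqF-> : i < k by case/andP: ik.
  case: eqP => [_ _|_]; last exact: pattern_parent.
  by exists [set: 'I_T.+1]%SET; rewrite ?inE ?finset.subsetT.
Defined.

Variables (U : finType) (s : 'I_T -> U).

(* The default [s r] is never used: [U] is inhabited as soon as there is a request. *)
Definition mask_requests (B : {set 'I_T.+1}) (r : 'I_T) : U :=
  if lift ord0 r \in B then s r else odflt (s r) [pick u : U].

(** Both sides allow at most one page: the unique ancestor [K] of [I] and the full interval, which
    has no ancestors, exchange their labels. *)
Lemma valid_flatten_top (I : leveled_interval T) (S : {set U}) : 1 < k ->
  pattern_intervals P I -> I.1 = k.-1 ->
  valid_tuple s P I S <->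
  joint_valid_tuple (mask_requests I.2) flatten_top (k, [set: 'I_T.+1]%SET) S.
Proof.
case: I => l B /= k1 /andP[/= /andP[l0 lk] BP] lE.
have lltk : l < k by lia.
have [||K KP BK] := @pattern_ancestor l k B _ _ BP; [by rewrite l0|by []|].
have kk : 0 < k <= k by rewrite leqnn andbT; lia.
have ancK J : ancestors P (l, B) J -> J = (k, K).
  case: J => i D /and3P[/andP[/= /andP[i0 ik] DP] /= li BD].
  have ik' : i = k by lia.
  have [|t tB] := pattern_nonempty _ BP; first by rewrite l0.
  rewrite ik' in DP *; congr pair.
  by apply: (pattern_eq kk DP KP (fintype.subsetP BD _ tB)); apply: (fintype.subsetP BK).
have Kanc : ancestors P (l, B) (k, K).
  by rewrite /ancestors /pattern_intervals /= kk KP lltk BK.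
have noanc J : ~~ ancestors flatten_top (k, [set: 'I_T.+1]%SET) J.
  by apply/negP => /and3P[/andP[/andP[_ Jk] _] /=]; rewrite ltnNge Jk.
rewrite /valid_tuple /joint_valid_tuple /= subnn (_ : k - l = 0 + 1); last by lia.
split=> -[S1 [alpha [feas anc]]]; split=> //.
  (* Below the top, intervals not contained in [I] carry the fixed page of the masked requests. *)
  exists (fun J : leveled_interval T => if J.1 == k then alpha (k, K)
                   else if J.2 \subset B then alpha J else [pick u : U]).
  split=> [r _|J [->|]]; last by rewrite (negbTE (noanc J)).
    rewrite /mask_requests /=; case: ifP => rB.
      have [[i D] [JI rJ aJ]] := feas _ rB.
      case/orP: JI => [/andP[/andP[/= /andP[i0 ik] DP] JI]|/ancK[]].
        have il : i <= l by case/orP: JI => [/eqP[-> _]|/andP[/ltnW]].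
        have DB : D \subset B by case/orP: JI => [/eqP[_ ->]|/andP[]].
        have iltk : i < k by apply: leq_ltn_trans il lltk.
        exists (i, D); split; rewrite //= ?ltn_eqF ?DB //.
        apply/orP; left; rewrite unfold_in /pattern_intervals /=.
        by rewrite i0 ik iltk finset.subsetT orbT ltn_eqF // DP.
      move=> ik DK; exists (k, [set: 'I_T.+1]%SET); split; rewrite ?inE //=.
        apply/orP; left; rewrite unfold_in /pattern_intervals /=.
        by rewrite kk eqxx inE !eqxx.
      by rewrite eqxx -ik -DK.
    have [|D DP rD] := @pattern_cover l (lift ord0 r); first by rewrite l0.
    exists (l, D); split=> //=.
      apply/orP; left; rewrite unfold_in /pattern_intervals /=.
      by rewrite l0 lk lltk finset.subsetT orbT ltn_eqF // DP.
    rewrite ltn_eqF // ifN; first by case: pickP => [//|/(_ (s r))].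
    by apply/negP => /fintype.subsetP/(_ _ rD); rewrite rB.
  by have := anc _ Kanc; rewrite /unlabeled_or_in /= eqxx.
exists (fun J : leveled_interval T => alpha (if J.1 == k then (k, [set: 'I_T.+1]%SET) else J)).
split=> [r rB|J /ancK ->]; last first.
  by rewrite /unlabeled_or_in /= eqxx; apply: anc; left.
have [|[i D] [JI rJ aJ]] := feas r; first by rewrite inE.
have aJ' : alpha (i, D) = Some (s r) by rewrite aJ /mask_requests rB.
case/orP: JI => [|JI]; last by case/negP: (noanc (i, D)).
case/andP => /andP[/= /andP[i0 ik] DP] JI.
move: ik; rewrite leq_eqVlt => /orP[/eqP ik|ik].
  exists (k, K); split; rewrite /= ?eqxx; [by apply/orP; right|exact: (fintype.subsetP BK)|].
  by move: DP; rewrite ik eqxx inE => /eqP <-; rewrite -ik.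
rewrite ltn_eqF // in DP.
exists (i, D); split; rewrite //= ?ltn_eqF //.
(* The level-[l] interval around [D] shares the time of [r] with [B], hence is [B], which puts [D]
   in the subtree of [I]. *)
have [||B' B'P DB'] := @pattern_ancestor i l D _ _ DP; [by rewrite i0; lia|by []|].
have EB : B' = B.
  by apply: (pattern_eq _ B'P BP _ rB); rewrite ?l0 ?lk //; apply: (fintype.subsetP DB').
rewrite EB in DB'; apply/orP; left; rewrite unfold_in /pattern_intervals /= i0 DP (ltnW ik) /=.
have : i <= l by lia.
rewrite leq_eqVlt DB' => /orP[/eqP il|->]; last by rewrite orbT.
rewrite il in DP *; rewrite (_ : D = B) ?eqxx //.
by apply: (pattern_eq _ DP BP rJ rB); rewrite l0.
Qed.

Lemma request_list_flatten_top (I : leveled_interval T) :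
  1 < k -> pattern_intervals P I -> I.1 = k.-1 ->
  request_list s P I =
  joint_request_list (mask_requests I.2) flatten_top (k, [set: 'I_T.+1]%SET).
Proof.
move=> k1 IP Ik; rewrite /request_list /joint_request_list.
suff -> : (fun S => `[< valid_tuple s P I S >]) = (fun S => `[< joint_valid_tuple
  (mask_requests I.2) flatten_top (k, [set: 'I_T.+1]%SET) S >]) by [].
by apply/funext => S; apply: asbool_equiv_eq; apply: valid_flatten_top.
Qed.

End Flatten.

(** * Bounds on the suprema *)

Lemma f_sup_le_n_sup (R : realType) (k : nat) : 1 < k ->
  (f_sup R k k.-1 1 <= n_sup R k k 1)%E.
Proof.
move=> k1; apply: le_ereal_sup => _ [U [T [s [P [I [IP Ik ->]]]]]].
exists U, T, (mask_requests s I.2), (flatten_top P), (k, [set: 'I_T.+1]%SET).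
split=> //; last by rewrite (request_list_flatten_top s k1 IP Ik).
by rewrite /pattern_intervals /= eqxx inE eqxx leqnn (ltnW k1).
Qed.

Lemma double_exp_le_f_sup (R : realType) (k : nat) : 1 < k ->
  (((2 : R) `^ ((2 : R) `^ (k%:R - 4)))%R%:E <= f_sup R k k.-1 1)%E.
Proof.
case: k => // d; rewrite ltnS => d0; rewrite /=.
have sel n : 0 < n -> selector d [set: 'I_n]%SET ->
    ((2 : R) `^ ((2 : R) `^ (d.+1%:R - 4)) <= n%:R)%R ->
    (((2 : R) `^ ((2 : R) `^ (d.+1%:R - 4)))%R%:E <= f_sup R d.+1 d 1)%E.
  by move=> n0 nsel nle; apply: le_trans (f_sup_ge R d0 n0 nsel); rewrite lee_fin.
(* For [k <= 3] the real exponent [k - 4] is negative, so the bound is at most [2]. *)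
have small n : d < 3 -> 1 < n ->
    ((2 : R) `^ ((2 : R) `^ (d.+1%:R - 4)) <= n%:R)%R.
  move=> d3 n1; apply: (@le_trans _ _ 2%R); last by rewrite ler_nat.
  rewrite -[leRHS](@powRr1 R); last by [].
  apply: ler_powR; first by rewrite ler1n.
  rewrite -[leRHS](@powRr0 R 2%R); apply: ler_powR; first by rewrite ler1n.
  by rewrite subr_le0 ler_nat leqW.
case: d d0 sel small => [//|[|[|j]]] _ sel small.
- by apply: (sel 2) (small 2 _ _) => //; apply: selector_pair; rewrite cardsT card_ord.
- by apply: (sel 3) (small 3 _ _) => //; apply: selector_three_four; rewrite cardsT card_ord.
(* Here [k = j + 4], and the smallest size provided at height [j + 3] already suffices. *)
apply: (sel (2 * 2 ^ 2 ^ j)).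
- by rewrite muln_gt0 expn_gt0.
- by apply: selector_double_exp; rewrite cardsT card_ord leqnn leq_mul2r orbT.
rewrite (_ : j.+4%:R - 4 = j%:R)%R; last by rewrite -addn4 natrD addrK.
rewrite powR_mulrn // -natrX powR_mulrn // -natrX ler_nat.
by rewrite leq_pmull.
Qed.

Theorem theorem4 (R : realType) (k : nat) (hk : (2 <= k)%N) :
  (n_sup R k k 1 >= f_sup R k k.-1 1)%E /\
  (f_sup R k k.-1 1 >= ((2 : R) `^ ((2 : R) `^ (k%:R - 4)))%R%:E)%E.
Proof. by split; [apply: f_sup_le_n_sup|apply: double_exp_le_f_sup]. Qed.
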